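(* Let $p>1$ and $\phi\in\mathcal A^p(M)$ with weak limit values $\phi_*$. If the measures $|\phi_j|^p\mu_j$ converge weak-* in $C(K)^*$ to a measure $\nu$ on $K$, then $\nu\ge|\phi_*|^p\mu$, i.e. $\nu(X)\ge\int_X|\phi_*|^p\,d\mu$ for every Borel set $X\subset K$.
   Context: $K$ is a compact metric space and $M=\{\mu_j\}_{j\ge1}$ is a sequence of finite positive regular Borel measures on $K$ converging weak-* in $C(K)^*$ (i.e. $\int h\,d\mu_j\to\int h\,d\mu$ for all $h\in C(K)$) to a finite positive Borel measure $\mu$. Write $K_j=\operatorname{supp}\mu_j$ and $K_0=\operatorname{supp}\mu$. A ''sequence'' $\phi=\{\phi_j\}$ means a sequence of real-valued Borel functions $\phi_j$ on $K_j$. For $p\ge 1$, $\|\phi\|_{L^p(M)}=\limsup_{j\to\infty}\|\phi_j\|_{L^p(K_j,\mu_j)}$. A sequence $\phi$ has weak limit values $\phi_*$ if $\phi_*$ is a $\mu$-integrable function on $K_0$ and $\int_{K_j}h\phi_j\,d\mu_j\to\int_{K_0}h\phi_*\,d\mu$ for every $h\in C(K)$. $\mathcal A(M)$ is the set of sequences having weak limit values, and $\mathcal A^p(M)$ the set of $\phi\in\mathcal A(M)$ with $\|\phi\|_{L^p(M)}<\infty$. *)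

(* Defs.v *)
From HB Require Import structures.
From mathcomp Require Import all_boot all_order all_algebra.
From mathcomp Require Import all_classical all_reals all_analysis.
Set Implicit Arguments. Unset Strict Implicit. Unset Printing Implicit Defensive.
Import Order.TTheory GRing.Theory Num.Theory.
Import numFieldNormedType.Exports.
Local Open Scope classical_set_scope.
Local Open Scope ring_scope.

#[short(type="pointedMetricType")]
HB.structure Definition PointedMetric (R : numDomainType) :=
  { M of Metric R M & Pointed M }.

Notation borel T := (g_sigma_algebraType (@open T)).

Definition supp {R : realType} {T : pointedMetricType R}
  (mu : set (borel T) -> \bar R) : set (borel T) :=
  [set x | forall U : set T, open U -> U x -> (0 < mu U)%E].

(* ||phi_j||_{L^p(K_j, mu_j)} : the library's L^p norm of phi_j restricted
   (patched by 0) to the support K_j of mu_j. *)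
Definition LpK {R : realType} {T : pointedMetricType R}
  (mu : {measure set (borel T) -> \bar R}) (p : R) (f : borel T -> R) : \bar R :=
  Lnorm mu p%:E ((EFin \o f) \_ (supp mu)).

Definition LpM {R : realType} {T : pointedMetricType R}
  (mu : nat -> {measure set (borel T) -> \bar R}) (p : R)
  (phi : nat -> borel T -> R) : \bar R :=
  limn_esup (fun j => LpK (mu j) p (phi j)).

Definition weak_star_cvg {R : realType} {T : pointedMetricType R}
  (mu : nat -> {measure set (borel T) -> \bar R})
  (mu0 : {measure set (borel T) -> \bar R}) : Prop :=
  forall h : T -> R, continuous h ->
    (fun j => (\int[mu j]_x (h x)%:E)%E) @ \oo --> (\int[mu0]_x (h x)%:E)%E.

Definition has_weak_limit_values {R : realType} {T : pointedMetricType R}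
  (mu : nat -> {measure set (borel T) -> \bar R})
  (mu0 : {measure set (borel T) -> \bar R})
  (phi : nat -> borel T -> R) (phistar : borel T -> R) : Prop :=
  mu0.-integrable (supp mu0) (EFin \o phistar) /\
  forall h : T -> R, continuous h ->
    (fun j => (\int[mu j]_(x in supp (mu j)) (h x * phi j x)%:E)%E) @ \oo -->
      (\int[mu0]_(x in supp mu0) (h x * phistar x)%:E)%E.

(* Main.v *)
(* Convexity gives, for every real u, an affine minorant
   p u a - c(u) <= |a|^p with c(u) = (p - 1) |u|^(p / (p - 1)), and |a|^p is the
   supremum of these minorants over the rational u. Multiplying by a continuous
   h with values in [0, 1], taking a = phi_j and integrating yields an inequality
   that is linear in phi_j, so it passes to the weak limit: h * p u phi_* has
   mu-integral at most that of h against nu + c(u) mu. Continuous functions being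
   enough to compare Borel measures, the integral of p u phi_* - c(u) over any
   Borel subset Y of K_0 is at most nu(Y). Cutting a set into pieces
   according to which of finitely many minorants is the largest replaces one
   minorant by a finite maximum, and monotone convergence concludes. *)
Require Import Defs.
From HB Require Import structures.
From mathcomp Require Import all_boot all_order all_algebra.
From mathcomp Require Import all_classical all_reals all_analysis.
From mathcomp Require Import measurable_realfun.
Import Order.TTheory GRing.Theory Num.Theory.
Import numFieldNormedType.Exports.
Local Open Scope classical_set_scope.
Local Open Scope ring_scope.

Set Implicit Arguments.

(** * Borel measurability and Baire functions with values in [[0, 1]] *)

Lemma continuous_measurable_borel {R : realType} {T : pointedMetricType R}
  (h : T -> R) : continuous h -> measurable_fun [set: borel T] (h : borel T -> R).
Proof.
move=> /continuousP ch; apply: (measurability _ (RGenOpens.measurableE R)).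
move=> _ [_ [a [b ->] <-]]; rewrite setTI.
by apply: sub_sigma_algebra; apply: ch; exact: interval_open.
Qed.

(* The [[0, 1]]-valued Baire functions. Dominated convergence propagates an
   inequality between integrals from continuous functions to this class, which
   replaces an appeal to the regularity of finite Borel measures. *)
Inductive baire_unit {R : realType} {T : topologicalType} (h : T -> R) : Prop :=
| baire_unit_continuous of continuous h & (forall x, 0 <= h x <= 1)
| baire_unit_cvg (f : nat -> T -> R) of (forall n, baire_unit (f n)) &
    (forall x, f^~ x @ \oo --> h x).

Section baire_unit.
Context {R : realType} {T : topologicalType}.
Implicit Types (f g : T -> R) (A B : set T).

Lemma baire_unit_itv f x : baire_unit f -> 0 <= f x <= 1.
Proof.
elim=> {f} [f _ f01|f F _ F01 Ff]; first exact: f01.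
have cF : cvgn (F^~ x) by apply/cvg_ex; exists (f x).
rewrite -(cvg_lim (@Rhausdorff R) (Ff x)); apply/andP; split.
  by apply: limr_ge => //; apply: nearW => n; case/andP: (F01 n).
by apply: limr_le => //; apply: nearW => n; case/andP: (F01 n).
Qed.

Lemma baire_unit_onem f : baire_unit f -> baire_unit (fun x => 1 - f x).
Proof.
elim=> {f} [f cf f01|f F _ F01 Ff].
  apply: baire_unit_continuous => x.
    by apply: cvgB; [exact: cvg_cst|exact: cf].
  by case/andP: (f01 x) => f0 f1; rewrite subr_ge0 f1 lerBlDr lerDl f0.
apply: (baire_unit_cvg _ (fun n x => 1 - F n x)) => // x.
by apply: cvgB; [exact: cvg_cst|exact: Ff].
Qed.

(** Two nested inductions: limits in [f] are removed first with [g] fixed, then limits in [g] with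
    [f] continuous. *)
Lemma baire_unitM f g :
  baire_unit f -> baire_unit g -> baire_unit (fun x => f x * g x).
Proof.
move=> bf bg; elim: bf => {f} [f cf f01|f F _ FM Ff]; last first.
  apply: (baire_unit_cvg _ (fun n x => F n x * g x)) => // x.
  by apply: cvgM; [exact: Ff|exact: cvg_cst].
elim: bg => {g} [g cg g01|g G _ GM Gg]; last first.
  apply: (baire_unit_cvg _ (fun n x => f x * G n x)) => // x.
  by apply: cvgM; [exact: cvg_cst|exact: Gg].
apply: baire_unit_continuous => x.
  by apply: cvgM; [exact: cf|exact: cg].
case/andP: (f01 x) (g01 x) => f0 f1 /andP[g0 g1].
by rewrite mulr_ge0//= mulr_ile1.
Qed.

Lemma baire_unit_cst (c : R) : 0 <= c <= 1 -> baire_unit (fun=> c : R) (T := T).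
Proof. by move=> c01; apply: baire_unit_continuous => // x; exact: cvg_cst. Qed.

Lemma baire_unitX f n : baire_unit f -> baire_unit (fun x => f x ^+ n).
Proof.
move=> bf; elim: n => [|n IHn].
  by apply: baire_unit_cst; rewrite ler01 lexx.
by under eq_fun do rewrite exprS; exact: baire_unitM.
Qed.

Lemma baire_unit_indic0 : baire_unit (\1_(set0 : set T) : T -> R).
Proof. by rewrite indic0; apply: baire_unit_cst; rewrite lexx ler01. Qed.

Lemma baire_unit_indicC A :
  baire_unit (\1_A : T -> R) -> baire_unit (\1_(~` A) : T -> R).
Proof.
move=> /baire_unit_onem; congr baire_unit; apply/funext => x.
by rewrite !indicE in_setC; case: (x \in A); rewrite ?subrr ?subr0.
Qed.

Lemma baire_unit_indicI A B : baire_unit (\1_A : T -> R) ->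
  baire_unit (\1_B : T -> R) -> baire_unit (\1_(A `&` B) : T -> R).
Proof. by move=> bA /(baire_unitM bA); rewrite indicI. Qed.

Lemma baire_unit_indicU A B : baire_unit (\1_A : T -> R) ->
  baire_unit (\1_B : T -> R) -> baire_unit (\1_(A `|` B) : T -> R).
Proof.
move=> bA bB; rewrite -(setCK (A `|` B)) setCU.
by apply/baire_unit_indicC/baire_unit_indicI; exact: baire_unit_indicC.
Qed.

(** At each point the indicators of the finite partial unions are eventually constant, equal to the
    indicator of the whole union. *)
Lemma baire_unit_indic_bigcup (F : nat -> set T) :
  (forall n, baire_unit (\1_(F n) : T -> R)) ->
  baire_unit (\1_(\bigcup_n F n) : T -> R).
Proof.
move=> bF; apply: (baire_unit_cvg _
    (fun n => \1_(\big[setU/set0]_(i < n) F i) : T -> R)).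
  elim=> [|n IHn]; first by rewrite big_ord0; exact: baire_unit_indic0.
  by rewrite big_ord_recr/=; exact: baire_unit_indicU.
move=> x; have [[k _ Fkx]|nFx] := pselect ((\bigcup_n F n) x).
  apply: cvg_near_cst; near=> n; rewrite !indicE !mem_set//; first by exists k.
  rewrite -bigcup_mkord; exists k => //=; near: n; exact: nbhs_infty_gt.
apply: cvg_near_cst; apply: nearW => n; rewrite !indicE !memNset// => Fx.
by apply: nFx; move: Fx; rewrite -bigcup_mkord => -[k _ Fkx]; exists k.
Unshelve. all: by end_near. Qed.

End baire_unit.

(* If [d] is the distance to a closed set [A], then [expR (- d) ^+ n] tends
   pointwise to the indicator function of [A]. *)
Lemma baire_unit_indic_closed {R : realType} {T : pointedMetricType R}
  (A : set T) : closed A -> baire_unit (\1_A : T -> R).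
Proof.
move=> cA; have [->|/set0P[a Aa]] := eqVneq A set0.
  exact: baire_unit_indic0.
(* The distance to [A] is at most the distance to [a], which is finite since the ball of radius
   [mdist x a + 1] around [x] contains [a]. *)
have dfin x : edist_inf A x \is a fin_num.
  rewrite ge0_fin_numE ?edist_inf_ge0//; apply: (@le_lt_trans _ _ (edist (x, a))).
    by apply: ereal_inf_lbound; exists a.
  rewrite -ge0_fin_numE ?edist_ge0//; apply/edist_finP; exists (mdist x a + 1).
    by rewrite ltr_wpDl// mdist_ge0.
  by rewrite /= ballEmdist/= ltrDl.
pose d x := fine (edist_inf A x).
have d0 x : 0 <= d x by rewrite fine_ge0 ?edist_inf_ge0.
have cd : continuous d.
  by move=> x; apply: fine_cvg; rewrite fineK//; exact: edist_inf_continuous.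
have bd : baire_unit (fun x => expR (- d x)).
  apply: baire_unit_continuous => x.
    apply: (continuous_comp (f := fun x => - d x) (g := expR)).
      by apply: cvgN; exact: cd.
    exact: continuous_expR.
  by rewrite expR_ge0/= -expR0 ler_expR oppr_le0.
apply: (baire_unit_cvg _ (fun n x => expR (- d x) ^+ n)) => [n|x].
  exact: baire_unitX.
have [Ax|nAx] := pselect (A x).
  rewrite indicE mem_set// /d edist_inf0//= oppr0 expR0.
  by under eq_fun do rewrite expr1n; exact: cvg_cst.
(* Off [A] the base is below 1: a zero distance would put [x] in the closure of [A]. *)
rewrite indicE memNset//; apply: cvg_expr.
rewrite ger0_norm ?expR_ge0// expR_lt1 oppr_lt0 lt_neqAle d0 andbT.
apply/eqP => dx0; apply: nAx; apply: cA => V /nbhs_ballP[e/= e0 eV].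
have : (edist_inf A x < e%:E)%E by rewrite -(fineK (dfin x)) -/(d x) -dx0 lte_fin.
move=> /ereal_inf_lt[_ [b Ab <-]] /edist_lt_ball xb.
by exists b; split => //; exact: eV.
Qed.

(** The sets whose indicator lies in the class form a sigma-algebra; it contains the closed sets,
    hence the open ones. *)
Lemma baire_unit_indic_borel {R : realType} {T : pointedMetricType R}
  (A : set (borel T)) : measurable A -> baire_unit (\1_A : T -> R).
Proof.
suff : @measurable _ (borel T) `<=` [set B : set T | baire_unit (\1_B : T -> R)].
  exact.
apply: smallest_sub.
  split => /= [|B bB|F bF]; first exact: baire_unit_indic0.
    by rewrite setTD; exact: baire_unit_indicC.
  exact: baire_unit_indic_bigcup.
move=> B oB /=; rewrite -(setCK B); apply: baire_unit_indicC.
by apply: baire_unit_indic_closed; exact: open_closedC.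
Qed.

Lemma baire_unit_measurable {R : realType} {T : pointedMetricType R}
  (f : T -> R) : baire_unit f -> measurable_fun [set: borel T] (f : borel T -> R).
Proof.
elim=> {f} [f cf _|f F _ mF Ff]; first exact: continuous_measurable_borel.
by apply: (measurable_fun_cvg (h := F : nat -> borel T -> R)) => // x _; exact: Ff.
Qed.

Lemma baire_unit_integrable {R : realType} {T : pointedMetricType R}
  (m : {measure set (borel T) -> \bar R}) (f : T -> R) :
  (m setT < +oo)%E -> baire_unit f -> m.-integrable [set: borel T] (EFin \o f).
Proof.
move=> moo bf; apply: measurable_bounded_integrable => //.
  exact: baire_unit_measurable.
exists 1; split => // M M1 x _ /=.
by case/andP: (baire_unit_itv x bf) => f0 f1; rewrite ger0_norm// (le_trans f1)// ltW.
Qed.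

(** * From continuous test functions to Borel sets *)

(** The inequality extends by induction to all [baire_unit] functions, with dominating functions
    [|g|] on the left and 1 on the right ([m] is finite). The choice [h = \1_X] then concludes. *)
Lemma le_integral_borel {R : realType} {T : pointedMetricType R}
  (mu m : {measure set (borel T) -> \bar R}) (D : set (borel T))
  (g : borel T -> R) :
  (m setT < +oo)%E -> measurable D -> mu.-integrable D (EFin \o g) ->
  (forall h : T -> R, continuous h -> (forall x, 0 <= h x <= 1) ->
    (\int[mu]_(x in D) (h x * g x)%:E <= \int[m]_x (h x)%:E)%E) ->
  forall X : set (borel T), measurable X -> X `<=` D ->
    (\int[mu]_(x in X) (g x)%:E <= m X)%E.
Proof.
move=> moo mD ig hle X mX XD.
suff ble (h : T -> R) : baire_unit h ->
    (\int[mu]_(x in D) (h x * g x)%:E <= \int[m]_x (h x)%:E)%E.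
  have := ble _ (baire_unit_indic_borel mX).
  rewrite integral_indic// setIT; apply: le_trans.
  rewrite -[X in (integral _ X _ <= _)%E](setIidr XD) integral_mkcondr.
  rewrite le_eqVlt; apply/orP; left; apply/eqP/eq_integral => x _.
  by rewrite patchE indicE; case: ifPn => _; rewrite ?mul1r ?mul0r.
have mg : measurable_fun D g by apply/measurable_EFinP; exact: measurable_int ig.
elim=> {h} [h ch h01|h H bH IH Hh]; first exact: hle.
have mH n : measurable_fun [set: borel T] (H n : borel T -> R).
  exact: baire_unit_measurable.
have cvgD : (\int[mu]_(x in D) (H n x * g x)%:E)%E @[n --> \oo] -->
    (\int[mu]_(x in D) (h x * g x)%:E)%E.
  apply: (dominated_cvg mD (g := EFin \o (fun x => `|g x|))) => //.
  - move=> n; apply/measurable_EFinP; apply: measurable_funM => //.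
    exact: measurable_funTS.
  - by move=> x _; apply: cvg_EFin; [exact: nearW|apply: cvgMr_tmp; exact: Hh].
  - exact: integrable_norm.
  - move=> n x _; rewrite /= lee_fin normrM ler_piMl//.
    by case/andP: (baire_unit_itv x (bH n)) => H0 H1; rewrite ger0_norm.
have cvgm : (\int[m]_x (H n x)%:E)%E @[n --> \oo] --> (\int[m]_x (h x)%:E)%E.
  apply: (dominated_cvg measurableT (g := EFin \o cst 1)) => //.
  - by move=> n; exact/measurable_EFinP.
  - by move=> x _; apply: cvg_EFin; [exact: nearW|exact: Hh].
  - apply: (@baire_unit_integrable _ _ m (cst 1)) => //; apply: baire_unit_cst.
    by rewrite ler01 lexx.
  - move=> n x _; rewrite /= lee_fin.
    by case/andP: (baire_unit_itv x (bH n)) => H0 H1; rewrite ger0_norm.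
rewrite -(cvg_lim (@ereal_hausdorff R) cvgD) -(cvg_lim (@ereal_hausdorff R) cvgm).
apply: lee_lim; [by apply/cvg_ex; eexists; exact: cvgD| |exact: nearW].
by apply/cvg_ex; eexists; exact: cvgm.
Qed.

(** * Suprema of countably many minorants *)

Lemma ge0_integral_sup_le d (T : measurableType d) (R : realType)
  (mu nu : {measure set T -> \bar R}) (D : set T)
  (l : nat -> T -> R) (f : T -> R) : measurable D ->
  (forall n, mu.-integrable D (EFin \o l n)) ->
  (forall n Y, measurable Y -> Y `<=` D ->
    (\int[mu]_(x in Y) (l n x)%:E <= nu Y)%E) ->
  (forall x, D x -> 0 <= f x) ->
  (forall n x, D x -> l n x <= f x) ->
  (forall x e, D x -> 0 < e -> exists n, f x - e < l n x) ->
  (\int[mu]_(x in D) (f x)%:E <= nu D)%E.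
Proof.
move=> mD il lnu f0 lf fl.
(* [M n] is the maximum of 0 and of the first [n] minorants. Starting from 0 keeps it nonnegative,
   as monotone convergence requires. *)
pose M := fix M n x := if n is k.+1 then Num.max (M k x) (l k x) else 0 : R.
have ml n : measurable_fun D (l n).
  by apply/measurable_EFinP; exact: measurable_int (il n).
have mM n : measurable_fun D (M n).
  by elim: n => [|n IHn] //=; exact: measurable_maxr.
have M0 n x : 0 <= M n x.
  by elim: n => [|n IHn] //=; rewrite le_max IHn.
have Mnd x : {homo M ^~ x : a b / (a <= b)%N >-> a <= b}.
  by apply/nondecreasing_seqP => n /=; rewrite le_max lexx.
have Mf n x : D x -> M n x <= f x.
  by move=> Dx; elim: n => [|n IHn] /=; rewrite ?f0// ge_max IHn lf.
have iM n : mu.-integrable D (EFin \o M n).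
  elim: n => [|n IHn] /=; first exact: integrable0.
  apply: (le_integrable mD (g := (EFin \o (fun x => `|M n x|)) \+
      (EFin \o (fun x => `|l n x|)))).
  - by apply/measurable_EFinP; exact: (mM n.+1).
  - move=> x Dx; rewrite /= lee_fin ger0_norm ?(M0 n.+1)// ger0_norm//.
    rewrite ge_max (ger0_norm (M0 n x)) lerDl normr_ge0/=.
    by rewrite (le_trans (ler_norm _))// lerDr.
  - by apply: integrableD => //; exact: integrable_norm.
have Mnu n Y : measurable Y -> Y `<=` D ->
    (\int[mu]_(x in Y) (M n x)%:E <= nu Y)%E.
  elim: n Y => [|n IHn] Y mY YD; first by rewrite integral0.
  (* On [Z] the new maximum is [l n], handled by [lnu]; on the rest of [Y] it is still [M n],
     handled by induction. Additivity of [nu] glues the two bounds. *)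
  pose Z := Y `&` [set x | M n x < l n x].
  have mZ : measurable Z.
    have mYMl : measurable_fun Y (fun x => M n x < l n x).
      by apply: measurable_fun_ltr; exact: measurable_funS YD _.
    exact: (mYMl mY [set true]).
  have mYZ : measurable (Y `\` Z) by exact: measurableD.
  have ZY : Z `<=` Y by exact: subIsetl.
  have dZ : Z `&` (Y `\` Z) = set0 by exact: setDIK.
  have -> : nu Y = (nu Z + nu (Y `\` Z))%E by rewrite -measureU// setDUK.
  rewrite -[X in integral _ X _](setDUK ZY) integral_setU//; last 2 first.
  - by rewrite setDUK//; apply/measurable_EFinP; exact: measurable_funS (mM n.+1).
  - exact/disj_set2P.
  apply: leeD.
    rewrite (eq_integral (fun x => (l n x)%:E)).
      by apply: lnu => //; exact: subset_trans YD.
    by move=> x; rewrite inE => -[_ /= Ml]; rewrite max_r// ltW.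
  rewrite (eq_integral (fun x => (M n x)%:E)).
    by apply: IHn => //; apply: subset_trans YD; exact: subDsetl.
  move=> x; rewrite inE => -[Yx nZx] /=; rewrite max_l// leNgt.
  by apply/negP => Ml; exact: nZx.
have Mlim x : D x -> limn (fun n => (M n x)%:E) = (f x)%:E.
  move=> Dx; apply/cvg_lim => //; apply: cvg_EFin; first exact: nearW.
  apply/cvgrPdist_le => e e0; have [k lk] := fl _ _ Dx e0.
  near=> n; rewrite ger0_norm ?subr_ge0 ?Mf// lerBlDr -lerBlDl.
  (* The index is [k.+1] because [M k] stops just before [l k]. *)
  apply: (le_trans (ltW lk)); apply: (@le_trans _ _ (M k.+1 x)).
    by rewrite /= le_max lexx orbT.
  by apply: Mnd; near: n; exact: nbhs_infty_gt.
have /cvg_lim : (\int[mu]_(x in D) (M n x)%:E)%E @[n --> \oo] -->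
    (\int[mu]_(x in D) limn (fun n => (M n x)%:E))%E.
  apply: cvg_monotone_convergence => //.
  - by move=> n; exact/measurable_EFinP.
  - by move=> n x _; rewrite lee_fin.
  - by move=> x _ a b ab; rewrite lee_fin Mnd.
rewrite (eq_integral (fun x => (f x)%:E)); last first.
  by move=> x; rewrite inE => /Mlim.
move=> <- //; apply: lime_le; last by apply: nearW => n; exact: Mnu.
apply: ereal_nondecreasing_is_cvgn => a b ab; apply: ge0_le_integral => //.
- by move=> x _; rewrite lee_fin.
- exact/measurable_EFinP.
- exact/measurable_EFinP.
- by move=> x _; rewrite lee_fin Mnd.
Unshelve. all: by end_near. Qed.

(** * Affine minorants of the power function *)

(* The affine minorants of [|a| ^ p] are indexed by [u = |s| ^ (p - 1) sgn s],
   where [s] is the point of tangency. *)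
Lemma powR_tangent_le {R : realType} (p u a : R) : 1 < p ->
  p * u * a - (p - 1) * `|u| `^ (p / (p - 1)) <= `|a| `^ p.
Proof.
move=> p1; have p0 : 0 < p by rewrite (lt_trans ltr01).
have q0 : 0 < p - 1 by rewrite subr_gt0.
have pq : p^-1 + (p / (p - 1))^-1 = 1.
  by rewrite invf_div -[X in X + _]mul1r -mulrDl addrC subrK divff// gt_eqF.
(* Young's inequality for [|a| * |u|] with exponents [p] and [p / (p - 1)]. Multiplied by [p], it
   gives the power of [|u|] the coefficient [p - 1]. *)
have := conjugate_powR (normr_ge0 a) (normr_ge0 u) p0 (divr_gt0 p0 q0) pq.
rewrite -(ler_pM2l p0) mulrDr invf_div.
rewrite [p * (_ / p)]mulrC divfK ?gt_eqF// [p * (_ * (_ / p))]mulrCA.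
rewrite [p * (_ / p)]mulrC divfK ?gt_eqF// => young.
rewrite lerBlDr [(p - 1) * _]mulrC; apply: le_trans young.
by rewrite -mulrA ler_pM2l// (mulrC u) -normrM ler_norm.
Qed.

(** The minorant tangent at [a] attains [|a| ^ p]; its value at [a] is continuous in the parameter,
    so a nearby rational parameter loses less than [e]. *)
Lemma powR_tangent_sup {R : realType} (p a e : R) : 1 < p -> 0 < e ->
  exists r : rat, `|a| `^ p - e <
    p * ratr r * a - (p - 1) * `|ratr r| `^ (p / (p - 1)).
Proof.
move=> p1 e0; have p0 : 0 < p by rewrite (lt_trans ltr01).
have q0 : 0 < p - 1 by rewrite subr_gt0.
have pq0 : 0 < p / (p - 1) by rewrite divr_gt0.
(* The case [a = 0] is separate because continuity is obtained below from derivability of the power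
   at a positive point [|v|]. *)
have [->|a0] := eqVneq a 0.
  exists 0; rewrite rmorph0 normr0 !powR0 ?gt_eqF//.
  by rewrite !mulr0 subr0 sub0r oppr_lt0.
pose F (u : R) := p * u * a - (p - 1) * `|u| `^ (p / (p - 1)).
pose v := Num.sg a * `|a| `^ (p - 1).
have a0' : 0 < `|a| by rewrite normr_gt0.
have normv : `|v| = `|a| `^ (p - 1).
  by rewrite normrM normr_sg a0 mul1r ger0_norm ?powR_ge0.
have v0 : 0 < `|v| by rewrite normv powR_gt0.
(* The two terms are [p |a| ^ p] and [(p - 1) |a| ^ p]. *)
have Fv : F v = `|a| `^ p.
  rewrite /F normv -powRrM [(p - 1) * (p / _)]mulrC divfK ?gt_eqF//.
  rewrite -[p * v * a]mulrA {1}/v mulrAC -normrEsg.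
  rewrite -{1}[`|a|]powRr1// -powRD; last by rewrite (gt_eqF a0') implybT.
  by rewrite (addrC 1) subrK mulrBl mul1r opprB addrCA subrr addr0.
have cF : F u @[u --> v] --> F v.
  apply: cvgB; apply: cvgM; [|exact: cvg_cst|exact: cvg_cst|].
    by apply: cvgM; [exact: cvg_cst|exact: cvg_id].
  apply: (@continuous_comp _ _ _ (fun u : R => `|u|)
    (fun x : R => x `^ (p / (p - 1))) v); first exact: norm_continuous.
  apply: differentiable_continuous; apply/derivable1_diffP.
  by apply: derivable_powR; rewrite in_itv/= v0.
have [||w []] := @dense_rat R [set u | `|a| `^ p - e < F u]^° _ _.
- by exists v; apply: (cvgr_gt (F v) cF); rewrite Fv ltrBlDr ltrDl.
- exact: open_interior.
- by move=> /interior_subset Fw [r _ rw]; exists r; rewrite rw.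
Qed.

(** * Supports and the inequality for a single measure *)

(** The support is closed: an open set witnessing that one point lies outside it does so for all its
    points. *)
Lemma supp_measurable {R : realType} {T : pointedMetricType R}
  (mu : set (borel T) -> \bar R) : measurable (supp mu).
Proof.
rewrite -(setCK (supp mu)); apply: measurableC; apply: sub_sigma_algebra.
rewrite /= openE => x /existsNP[U /not_implyP[oU /not_implyP[Ux nU]]].
apply: (filterS (P := U)); last exact: open_nbhs_nbhs.
by move=> y Uy; apply/existsNP; exists U => /(_ oU Uy).
Qed.

Lemma integral_tangent_le d (T : measurableType d) (R : realType)
  (mu : {finite_measure set T -> \bar R}) (K : set T) (h phi : T -> R) (p u : R) :
  1 < p -> measurable K -> measurable_fun setT h -> (forall x, 0 <= h x <= 1) ->
  measurable_fun K phi ->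
  (\int[mu]_(x in K) (h x * `|phi x| `^ p)%:E < +oo)%E ->
  ((p * u)%:E * \int[mu]_(x in K) (h x * phi x)%:E <=
   \int[mu]_(x in K) (h x * `|phi x| `^ p)%:E +
   ((p - 1) * `|u| `^ (p / (p - 1)))%:E * \int[mu]_x (h x)%:E)%E.
Proof.
move=> p1 mK mh h01 mphi fin.
have h0 x : 0 <= h x by case/andP: (h01 x).
have mhK : measurable_fun K h by exact: measurable_funTS.
have mphip : measurable_fun K (fun x => `|phi x| `^ p).
  by apply: (measurableT_comp (measurable_powR p)); exact: measurableT_comp.
have ihp : mu.-integrable K (EFin \o (fun x => h x * `|phi x| `^ p)).
  apply/integrableP; split; first by apply/measurable_EFinP; exact: measurable_funM.
  under eq_integral do rewrite gee0_abs ?lee_fin ?mulr_ge0 ?powR_ge0//.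
  exact: fin.
have ihT : mu.-integrable setT (EFin \o h).
  apply: measurable_bounded_integrable => //; first exact: fin_num_fun_lty.
  exists 1; split => // M M1 x _ /=.
  by case/andP: (h01 x) => ? h1; rewrite ger0_norm// (le_trans h1)// ltW.
have ih : mu.-integrable K (EFin \o h) by exact: integrableS ihT.
have ihphi : mu.-integrable K (EFin \o (fun x => h x * phi x)).
  apply: (le_integrable mK (g := (EFin \o (fun x => h x * `|phi x| `^ p)) \+
      (EFin \o h))); last exact: integrableD.
    by apply/measurable_EFinP; exact: measurable_funM.
  move=> x Kx; rewrite /= lee_fin [X in _ <= X]ger0_norm; last first.
    by rewrite addr_ge0// mulr_ge0// powR_ge0.
  rewrite normrM ger0_norm// -[X in _ + X]mulr1 -mulrDr ler_wpM2l//.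
  (* Integrability of [h * phi] rests on [|phi| <= |phi| ^ p + 1], checked separately for
     [|phi| <= 1] and [|phi| > 1]. *)
  have [phi1|phi1] := leP `|phi x| 1.
    by rewrite (le_trans phi1)// lerDr powR_ge0.
  rewrite -[X in X <= _]powRr1// (@le_trans _ _ (`|phi x| `^ p))//.
    by rewrite ler_powR// ltW.
  by rewrite lerDl.
set c := (p - 1) * _.
have c0 : 0 <= c by rewrite mulr_ge0 ?powR_ge0// subr_ge0 ltW.
rewrite -integralZl//; apply: (@le_trans _ _
    (\int[mu]_(x in K) ((h x * `|phi x| `^ p)%:E + c%:E * (h x)%:E))%E).
  apply: le_integral => //; [exact: integrableZl| |].
    by apply: integrableD => //; exact: integrableZl.
  move=> x _; rewrite /= lee_fin (mulrCA (p * u)) (mulrC c) -lerBlDr -mulrBr.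
  by rewrite ler_wpM2l// powR_tangent_le.
rewrite integralD//; last exact: integrableZl.
apply: leeD => //; rewrite integralZl//; apply: lee_wpmul2l; rewrite ?lee_fin//.
(* The integral of [h >= 0] is enlarged from [K] to the whole space, the form in which weak-*
   convergence of the measures applies. *)
apply: ge0_subset_integral => //; first exact/measurable_EFinP.
by move=> x _; rewrite lee_fin.
Qed.

(** * Passage to the weak limit *)

Unset Implicit Arguments.

Theorem theorem2p2 (R : realType) (T : pointedMetricType R)
  (Tcompact : compact [set: T])
  (mu : nat -> {finite_measure set (borel T) -> \bar R})
  (mu0 : {finite_measure set (borel T) -> \bar R})
  (Hmu : weak_star_cvg mu mu0)
  (p : R) (p1 : 1 < p)
  (phi : nat -> borel T -> R)
  (phimeas : forall j, measurable_fun (supp (mu j)) (phi j))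
  (phistar : borel T -> R)
  (Hphi : has_weak_limit_values mu mu0 phi phistar)
  (HLp : (LpM mu p phi < +oo)%E)
  (nu : {finite_measure set (borel T) -> \bar R})
  (Hnu : forall h : T -> R, continuous h ->
     (fun j => (\int[mu j]_(x in supp (mu j)) (h x * `|phi j x| `^ p)%:E)%E) @ \oo
       --> (\int[nu]_x (h x)%:E)%E) :
  forall X : set (borel T), measurable X ->
    (\int[mu0]_(x in X `&` supp mu0) (`|phistar x| `^ p)%:E <= nu X)%E.
Proof.
move=> X mX.
have [iphistar Hphilim] := Hphi.
set K0 := supp mu0 in iphistar Hphilim *.
have mK0 : measurable K0 by exact: supp_measurable.
have mXK : measurable (X `&` K0) by exact: measurableI.
have mphistar : measurable_fun K0 phistar.
  by apply/measurable_EFinP; exact: measurable_int iphistar.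
pose c (u : R) := (p - 1) * `|u| `^ (p / (p - 1)).
have c0 u : 0 <= c u by rewrite mulr_ge0 ?powR_ge0// subr_ge0 ltW.
have il u : mu0.-integrable K0 (EFin \o (fun x => p * u * phistar x)).
  by apply: eq_integrable (integrableZl mK0 (p * u) iphistar) => // x _.
have tangent_cvg u (h : T -> R) : continuous h -> (forall x, 0 <= h x <= 1) ->
    (\int[mu0]_(x in K0) (h x * (p * u * phistar x))%:E <=
     \int[nu]_x (h x)%:E + (c u)%:E * \int[mu0]_x (h x)%:E)%E.
  move=> ch h01.
  have mh : measurable_fun [set: borel T] (h : borel T -> R).
    exact: continuous_measurable_borel.
  have h0 x : 0 <= h x by case/andP: (h01 x).
  have bh : baire_unit h by exact: baire_unit_continuous.
  have ihfin (m : {finite_measure set (borel T) -> \bar R}) :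
      (\int[m]_x (h x)%:E)%E \is a fin_num.
    apply: integrable_fin_num => //; apply: baire_unit_integrable => //.
    exact: fin_num_fun_lty.
  have ihphi : mu0.-integrable K0 (EFin \o (fun x => h x * phistar x)).
    apply: (le_integrable mK0) iphistar.
      by apply/measurable_EFinP; apply: measurable_funM => //; exact: measurable_funTS.
    move=> x _; rewrite /= lee_fin normrM ler_piMl// ger0_norm//.
    by case/andP: (h01 x).
  have -> : (\int[mu0]_(x in K0) (h x * (p * u * phistar x))%:E =
      (p * u)%:E * \int[mu0]_(x in K0) (h x * phistar x)%:E)%E.
    rewrite -(integralZl mK0 ihphi); apply: eq_integral => x _.
    by rewrite -EFinM mulrCA.
  have lcvg := cvgeZl (y := (p * u)%:E) isT (Hphilim h ch).
  have rcvg : ((\int[mu j]_(x in supp (mu j)) (h x * `|phi j x| `^ p)%:E +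
      (c u)%:E * \int[mu j]_x (h x)%:E)%E @[j --> \oo] -->
      (\int[nu]_x (h x)%:E + (c u)%:E * \int[mu0]_x (h x)%:E)%E).
    apply: cvgeD; [|exact: Hnu|by apply: cvgeZl => //; exact: Hmu].
    by rewrite fin_num_adde_defr// ihfin.
  rewrite -(cvg_lim (@ereal_hausdorff R) lcvg) -(cvg_lim (@ereal_hausdorff R) rcvg).
  apply: lee_lim; [by apply/cvg_ex; eexists; exact: lcvg
                  |by apply/cvg_ex; eexists; exact: rcvg|].
  (* The limit is finite, so the integrals of [h * |phi j| ^ p] are finite for large [j]; this
     supplies the finiteness assumption of [integral_tangent_le]. *)
  have : (\int[mu j]_(x in supp (mu j)) (h x * `|phi j x| `^ p)%:E)%E @[j --> \oo]
      --> (fine (\int[nu]_x (h x)%:E))%:E by rewrite fineK//; exact: Hnu.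
  move=> /fine_cvgP[+ _]; apply: filterS => j fj.
  apply: integral_tangent_le => //.
  - exact: supp_measurable.
  - exact: phimeas.
  - by case/andP: (fin_numPlt _ fj).
have tangent_le u (Y : set (borel T)) : measurable Y -> Y `<=` X `&` K0 ->
    (\int[mu0]_(x in Y) (p * u * phistar x - c u)%:E <= nu Y)%E.
  move=> mY YXK; have YK : Y `<=` K0 by apply: subset_trans YXK _; exact: subIsetr.
  (* With the constant term moved to the right, [le_integral_borel] compares with the single finite
     measure [nu + c u * mu0]. The added term is subtracted again at the end, [mu0 Y] being
     finite. *)
  pose m : {measure set (borel T) -> \bar R} :=
    measure_add nu (mscale (NngNum (c0 u)) mu0).
  have mE Z : m Z = (nu Z + (c u)%:E * mu0 Z)%E by exact: measure_addE.
  have moo : (m setT < +oo)%E.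
    by rewrite mE lte_add_pinfty ?lte_mul_pinfty ?lee_fin// ?fin_num_fun_lty.
  have muY := fin_num_measure mu0 Y mY.
  have : (\int[mu0]_(x in Y) (p * u * phistar x)%:E <= m Y)%E.
    apply: (le_integral_borel mu0 m moo mK0 (il u) _ mY YK) => // h ch h01.
    have h0 x : (0 <= (h x)%:E)%E by rewrite lee_fin; case/andP: (h01 x).
    have mh : measurable_fun [set: borel T] (EFin \o h : borel T -> \bar R).
      by apply/measurable_EFinP; exact: continuous_measurable_borel.
    rewrite ge0_integral_measure_add// ge0_integral_mscale//.
    exact: tangent_cvg.
  rewrite mE => lem.
  rewrite integralB_EFin//; last 2 first.
  - exact: integrableS (il u).
  - exact: finite_measure_integrable_cst.
  rewrite integral_cst//.
  by rewrite leeBlDr ?fin_numM.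
apply: (@le_trans _ _ (nu (X `&` K0))); last first.
  by apply: le_measure; rewrite ?inE//; exact: subIsetl.
(* An enumeration of the rationals; codes that decode to nothing yield the parameter 0, whose
   minorant is as valid as any other. *)
pose r n : R := ratr (odflt (0 : rat) (unpickle n)).
apply: (@ge0_integral_sup_le _ _ _ mu0 nu (X `&` K0)
  (fun n x => p * r n * phistar x - c (r n))) => //.
- move=> n; apply: (integrableS mK0 mXK); first exact: subIsetr.
  by apply: eq_integrable (integrableB mK0 (il (r n))
    (finite_measure_integrable_cst mu0 (c (r n)) mK0)) => // x _.
- by move=> n Y mY YXK; exact: tangent_le.
- by move=> n x _; exact: powR_tangent_le.
- move=> x e _ e0; have [q hq] := powR_tangent_sup p (phistar x) e p1 e0.
  by exists (pickle q); rewrite /r pickleK.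
Qed.
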